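(* Let $k\ge2$, let $\nu$ be a probability measure on $\mathcal{P}_{\mathrm m}^{(k)}$ such that $\nu((1,0,\ldots,0))<1$, and for $n\ge1$ let $Q_n(\cdot,\cdot;\nu)$ be the $\mathrm{CP}(\nu)$-ancestral branching Markov kernel on $\mathcal{T}_n^{(k)}$. Then for each $n\ge1$ there exists a unique probability measure $\rho_n(\cdot;\nu)$ on $\mathcal{T}_n^{(k)}$ which is stationary for $Q_n(\cdot,\cdot;\nu)$.
   Context: A fragmentation tree of a finite set $A\subset\mathbb{N}$ is a collection $T$ of non-empty subsets of $A$ with $A\in T$ (the root), containing all singletons, any two elements being disjoint or nested. The parent of $t\neq A$ is the smallest element of $T$ strictly containing $t$; the children of $t$ are the elements with parent $t$; the root partition $\Pi_T$ is the set of children of the root (for $\#A\ge2$). $T_{|S}=\{t\cap S:t\in T\}\setminus\{\emptyset\}$. $[n]=\{1,\dots,n\}$; $\mathcal{T}_n^{(k)}$ is the set of fragmentation trees of $[n]$ in which every vertex has at most $k$ children. $\mathbf{1}_b=\{b\}$. $\mathcal{P}_{\mathrm m}^{(k)}=\{s=(s_1\ge s_2\ge\dots\ge0): s_j=0\ \forall j>k,\ \sum_j s_j=1\}$. The paintbox $\varrho_s$ is the law of the random partition of $\mathbb{N}$ with $i\sim j$ iff $X_i=X_j$, where $X_1,X_2,\dots$ are i.i.d. with $P(X_i=j)=s_j$; $\varrho_\nu=\int\varrho_s\,\nu(ds)$. For a partition $\sigma$ of a finite set $c$, $\varrho_\nu(\sigma)$ is the probability that a $\varrho_\nu$-partition restricted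 to $c$ equals $\sigma$. For finite $b\subset\mathbb{N}$ and partitions $\pi,\pi'$ of $b$ with at most $k$ blocks, $$p_b(\pi,\pi';\nu)=\frac{k!}{(k-\#\pi')!}\prod_{c\in\pi}\frac{(k-\#\pi'_{|c})!}{k!}\varrho_\nu(\pi'_{|c}),$$ where $\pi'_{|c}$ is the restriction of $\pi'$ to $c$. The $\mathrm{CP}(\nu)$-ancestral branching kernel on $\mathcal{T}_n^{(k)}$ is $$Q_n(T,T';\nu)=\prod_{b\in T':\#b\ge2}\frac{p_b(\Pi_{T_{|b}},\Pi_{T'_{|b}};\nu)}{1-p_b(\Pi_{T_{|b}},\mathbf{1}_b;\nu)}.$$ *)

(* Defs.v *)
From HB Require Import structures.
From mathcomp Require Import all_boot all_order all_algebra.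

Set Implicit Arguments.
Unset Strict Implicit.
Unset Printing Implicit Defensive.

Import Order.TTheory GRing.Theory Num.Theory.

Local Open Scope ring_scope.

Section FragmentationTrees.
Variable I : finType.
Implicit Types (A S t u v : {set I}) (T : {set {set I}}).

Definition is_fragtree A T : bool :=
  [&& A \in T, T \subset powerset A, set0 \notin T,
      [forall i in A, [set i] \in T] &
      [forall t in T, forall u in T,
         [|| [disjoint t & u], t \subset u | u \subset t]]].

Definition is_parent T u t : bool :=
  [&& u \in T, t \proper u &
      [forall v in T, (t \proper v) ==> (u \subset v)]].

Definition children T u : {set {set I}} := [set t in T | is_parent T u t].

(* The root A is explicit: T is meant to be a fragmentation tree of A. *)
Definition root_partition A T : {set {set I}} := children T A.

(* Serves both for trees (T_{|S}) and for partitions (pi_{|c}). *)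
Definition restr T S : {set {set I}} := [set t :&: S | t in T] :\ set0.

Definition max_children (k : nat) T : bool :=
  [forall t in T, (#|children T t| <= k)%N].

End FragmentationTrees.

(* The ground set [n] = {1, ..., n} is represented by 'I_n. *)
Definition fragtree (k n : nat) : Type :=
  {T : {set {set 'I_n}} | is_fragtree [set: 'I_n] T && max_children k T}.

HB.instance Definition _ k n := Finite.on (fragtree k n).

(* Required only here because classical_sets shadows the names set0, powerset
   and others of finset used above. *)
From mathcomp Require Import all_classical all_reals all_analysis.

Import numFieldNormedType.Exports.

Section CutAndPaste.
Variables (R : realType) (k : nat).

(* A sequence vanishing beyond index k is identified with the k-tuple of its
   first k terms; k.-tuple carries the product (Borel) sigma-algebra. *)
Notation seqk := (k.-tuple (measurableTypeR R)).

Definition mass_partitions : set seqk :=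
  [set s : seqk | [/\ forall i j : 'I_k, (i <= j)%N -> tnth s j <= tnth s i,
                      forall i : 'I_k, 0 <= tnth s i
                    & \sum_(i < k) tnth s i = 1 ]]%classic.

Definition unit_mass : seqk := [tuple (val i == 0%N)%:R | i < k].

Section Kernel.
Variable n : nat.
Implicit Types (s : seqk) (b c : {set 'I_n}) (pi sigma : {set {set 'I_n}}).

Definition label_partition (x : 'I_n -> 'I_k) : {set {set 'I_n}} :=
  preim_partition x [set: 'I_n].

(* rho_s(sigma) for a partition sigma of c: the labels X_1, ..., X_n are i.i.d.
   with law s, so (X_1, ..., X_n) = x has probability \prod_i s_(x_i); see
   [paintboxP] below for an actual i.i.d. sequence. *)
Definition paintbox s c sigma : R :=
  \sum_(x : {ffun 'I_n -> 'I_k} | restr (label_partition x) c == sigma)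
     \prod_(i < n) tnth s (x i).

Variable nu : probability seqk R.

Definition paintbox_mix c sigma : R :=
  \int[nu]_(s in mass_partitions) paintbox s c sigma.

Definition cp_prob pi pi' : R :=
  k`!%:R / (k - #|pi'|)`!%:R *
  \prod_(c in pi) ((k - #|restr pi' c|)`!%:R / k`!%:R
                   * paintbox_mix c (restr pi' c)).

Definition branching_kernel (T T' : fragtree k n) : R :=
  \prod_(b in val T' | (2 <= #|b|)%N)
     (cp_prob (root_partition b (restr (val T) b))
              (root_partition b (restr (val T') b))
      / (1 - cp_prob (root_partition b (restr (val T) b)) [set b])).

End Kernel.

Section Paintbox_iid.
Context {d : measure_display} {Omega : measurableType d}.
Variables (P : probability Omega R) (X : nat -> Omega -> 'I_k) (s : seqk).

Definition iid_labels : Prop :=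
  (forall i j, measurable (X i @^-1` [set j])%classic) /\
  (forall m (x : 'I_m -> 'I_k),
     P [set w | forall i : 'I_m, X i w = x i]%classic
     = (\prod_(i < m) tnth s (x i))%:E).

Lemma paintboxP n (c : {set 'I_n}) (sigma : {set {set 'I_n}}) :
  iid_labels ->
  P [set w | restr (label_partition (fun i : 'I_n => X i w)) c = sigma]%classic
  = (paintbox s c sigma)%:E.
Proof.
move=> [mX iidX].
pose A (x : {ffun 'I_n -> 'I_k}) : set Omega :=
  [set w | forall i : 'I_n, X i w = x i]%classic.
have mA x : measurable (A x).
  have -> : A x = (\bigcap_(i in [set` 'I_n]) (X i @^-1` [set x i]))%classic.
    by apply/seteqP; split => w /= h i; [move=> _|]; apply: h.
  exact: fin_bigcap_measurable.
pose r := [seq x : {ffun 'I_n -> 'I_k} <- index_enum _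
              | restr (label_partition x) c == sigma].
have memr x : (x \in r) = (restr (label_partition x) c == sigma).
  by rewrite mem_filter mem_index_enum andbT.
rewrite (_ : mkset _ = (\bigcup_(x in [set` r]) A x)%classic); last first.
  apply/seteqP; split => w /=.
  - move=> h; exists [ffun i : 'I_n => X i w]; last by move=> i; rewrite ffunE.
    rewrite /= memr -h; apply/eqP; congr (restr (preim_partition _ _) _).
    by apply/funext => i; rewrite ffunE.
  - case=> x /=; rewrite memr => /eqP <- Aw.
    by congr (restr (preim_partition _ _) _); apply/funext => i; exact: Aw.
rewrite measure_fin_bigcup//=; last first.
  move=> x y _ _ [w [Ax Ay]]; apply/ffunP => i.
  by rewrite -(Ax i) -(Ay i).
rewrite -fsbig_seq ?filter_uniq ?index_enum_uniq// /r big_filter /paintbox.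
by rewrite -sumEFin; apply: eq_bigr => x _; exact: (iidX n x).
Qed.

End Paintbox_iid.

End CutAndPaste.

Arguments mass_partitions R k : clear implicits.
Arguments unit_mass R k : clear implicits.

Section FiniteMarkov.
Variables (R : realType) (E : finType).

Definition is_distribution (rho : {ffun E -> R}) : Prop :=
  (forall x, 0 <= rho x) /\ \sum_x rho x = 1.

Definition is_stationary (Q : E -> E -> R) (rho : {ffun E -> R}) : Prop :=
  forall y, \sum_x rho x * Q x y = rho y.

End FiniteMarkov.

(* Main.v *)
(* A chain on a finite set has a unique stationary law as soon as some state y0
   satisfies Q(x, y0) > 0 for every x.  Here y0 is any binary tree: since nu
   charges {s_2 > 0}, a partition into at most two blocks has positive paintbox
   probability on every c, hence p_b(pi, pi') > 0 whenever pi' has two blocks.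
   That Q_n is stochastic follows by building T' from the root downwards, once
   p_b(pi, .) is known to be a probability: k!/(k - #pi')! counts the labellings
   of b by [k] that induce pi', so p_b(pi, .) is the law of the partition induced
   by labelling each block c of pi independently, through a paintbox partition
   of c whose blocks receive distinct uniform labels.  As p_b(pi, .) charges the
   two-block partitions, 1 - p_b(pi, 1_b) > 0. *)
Require Import Defs.
From mathcomp Require Import all_boot all_order all_algebra.

Set Implicit Arguments.
Unset Strict Implicit.
Unset Printing Implicit Defensive.

Import Order.TTheory GRing.Theory Num.Theory.

Local Open Scope ring_scope.

(** * Partitions of a finite set induced by labelling its elements *)

Section Labellings.
Variables (I J : finType).
Implicit Types (b c : {set I}) (pi : {set {set I}}).

(** Both sides group the elements of [c] by label. Hence the trace on [c] of an induced partition
    depends only on the labels inside [c]. *)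
Lemma restr_preim_partition (x : I -> J) b c :
  c \subset b -> restr (preim_partition x b) c = preim_partition x c.
Proof.
move=> /subsetP cb; apply/setP => B; rewrite in_setD1; apply/andP/imsetP.
- move=> [/set0Pn[i iB] /imsetP[t /imsetP[j jb ->] defB]].
  move: iB; rewrite defB !inE => /andP[/andP[ib /eqP xji] ic].
  exists i => //; apply/setP => l; rewrite !inE xji.
  by case: (boolP (l \in c)) => lc; rewrite ?andbF ?andbT //= cb.
- move=> [i ic ->]; split.
    by apply/set0Pn; exists i; rewrite !inE ic eqxx.
  apply/imsetP; exists [set l in b | x i == x l].
    by apply/imsetP; exists i => //; exact: cb.
  apply/setP => l; rewrite !inE.
  by case: (boolP (l \in c)) => lc; rewrite ?andbF ?andbT //= cb.
Qed.

Lemma eq_preim_partition (x y : I -> J) c :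
  {in c, x =1 y} -> preim_partition x c = preim_partition y c.
Proof.
move=> xy; apply: eq_in_imset => i ic; apply/setP => j; rewrite !inE.
by case: (boolP (j \in c)) => //= jc; rewrite !xy.
Qed.

Lemma card_preim_partition (x : I -> J) b : (#|preim_partition x b| <= #|J|)%N.
Proof.
have -> : preim_partition x b
    = [set [set l in b | j == x l] | j in [set x i | i in b]].
  by apply/setP => B; rewrite -imset_comp.
by rewrite (leq_trans (leq_imset_card _ _)) // max_card.
Qed.

Lemma pblock_preim_partition (x : I -> J) b i j :
  i \in b -> j \in b ->
  (pblock (preim_partition x b) i == pblock (preim_partition x b) j)
  = (x i == x j).
Proof.
move=> ib jb; have /and3P[/eqP cov triv _] := preim_partitionP x b.
rewrite eq_pblock ?cov // pblock_equivalence_partition //.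
by split=> // /eqP->.
Qed.

Lemma eq_preim_partitionP (x : I -> J) pi b : partition pi b ->
  reflect {in b &, forall i j, (x i == x j) = (pblock pi i == pblock pi j)}
          (preim_partition x b == pi).
Proof.
move=> pib; apply: (iffP eqP) => [<- i j ib jb|xpi].
  by rewrite pblock_preim_partition.
rewrite -(equivalence_partition_pblock pib).
have /and3P[/eqP cov triv _] := pib.
apply: eq_in_imset => i ib; apply/setP => j; rewrite !inE.
by case: (boolP (j \in b)) => //= jb; rewrite xpi // eq_pblock // cov.
Qed.

Variable j0 : J.
(** Labellings of [b] are encoded as total functions with the default value [j0] outside [b], so
    that each labelling of [b] is counted exactly once. *)
Notation labellings b := (pffun_on j0 b J).

Lemma labellingsP b (x : {ffun I -> J}) :
  reflect (forall i, i \notin b -> x i = j0) (x \in labellings b).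
Proof.
apply: (iffP (@pffun_onP _ _ j0 b J x)) => [[/subsetP sx _] i|xb].
  by apply: contraNeq => xi; apply: sx.
split=> //; apply/subsetP => i; rewrite inE; apply: contraNT => ib.
by apply/eqP/xb.
Qed.

(** A labelling induces [pi] exactly when it is constant on blocks with distinct values on distinct
    blocks, that is, when it comes from an injection of the blocks into [J]. *)
Lemma card_labellings pi b : partition pi b ->
  #|[set x : {ffun I -> J} in labellings b | preim_partition x b == pi]|
  = (#|J| ^_ #|pi|)%N.
Proof.
move=> pib; have /and3P[/eqP cov triv n0] := pib.
have piP (B : {c | c \in pi}) : exists i, i \in val B.
  by apply/set0Pn; apply: contraNneq n0 => <-; exact: valP.
have bpi i (ib : i \in b) : pblock pi i \in pi by rewrite pblock_mem ?cov.
pose blk i ib : {c | c \in pi} := exist (fun c => c \in pi) _ (bpi i ib).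
(* [f] reads the label of each block at a chosen representative; [g] spreads one label per block
   over the elements of that block. *)
pose f (x : {ffun I -> J}) : {ffun {c | c \in pi} -> J} :=
  [ffun B => x (xchoose (piP B))].
pose g (y : {ffun {c | c \in pi} -> J}) : {ffun I -> J} :=
  [ffun i => if insub (pblock pi i) is Some B then
             if i \in b then y B else j0 else j0].
have chb B : xchoose (piP B) \in b.
  by rewrite -cov; apply/bigcupP; exists (val B); [exact: valP|exact: xchooseP].
have pch B : pblock pi (xchoose (piP B)) = val B.
  by apply: def_pblock => //; [exact: valP|exact: xchooseP].
have gE y i B : i \in b -> pblock pi i = val B -> g y i = y B.
  by move=> ib iB; rewrite ffunE iB valK ib.
rewrite -[X in (_ ^_ X)%N]card_sig -card_inj_ffuns.
rewrite -(card_in_imset (f := g)) /=; last first.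
  move=> y z _ _ yz; apply/ffunP => B.
  have := congr1 (fun h : {ffun I -> J} => h (xchoose (piP B))) yz.
  rewrite /= !(gE _ _ B) ?chb ?pch //.
apply: eq_card => x; apply/idP/imsetP => [|[y]].
- rewrite inE => /andP[/labellingsP xb /(eq_preim_partitionP _ pib) xpi].
  exists (f x).
    rewrite inE; apply/injectiveP => B C; rewrite !ffunE => /eqP.
    by rewrite xpi // !pch => /eqP /val_inj.
  apply/ffunP => i; case: (boolP (i \in b)) => ib; last first.
    by rewrite xb // ffunE (negPf ib); case: insub.
  by rewrite (gE _ _ (blk i ib)) // ffunE; apply/eqP; rewrite xpi // pch.
- move=> + ->; rewrite !inE => /injectiveP inj; apply/andP; split.
    by apply/labellingsP => i ib; rewrite ffunE (negPf ib); case: insub.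
  apply/(eq_preim_partitionP _ pib) => i j ib jb.
  by rewrite (gE _ _ (blk i ib)) // (gE _ _ (blk j jb)) // (inj_eq inj) -val_eqE.
Qed.

(** Labellings are grouped by the partition they induce; the multiplicity is the factor k!/(k -
    #pi)! of the cut-and-paste probabilities. *)
Lemma sum_preim_partition (R : pzSemiRingType) b (F : {set {set I}} -> R) :
  \sum_(x : {ffun I -> J} | x \in labellings b) F (preim_partition x b)
  = \sum_(pi | partition pi b && (#|pi| <= #|J|)%N) F pi *+ (#|J| ^_ #|pi|).
Proof.
rewrite (partition_big (fun x : {ffun I -> J} => preim_partition x b)
  (fun pi => partition pi b && (#|pi| <= #|J|)%N)) /=; last first.
  by move=> x _; rewrite preim_partitionP card_preim_partition.
apply: eq_bigr => pi /andP[pib _].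
rewrite (eq_bigr (fun=> F pi)); last by move=> x /andP[_ /eqP->].
by rewrite sumr_const -(card_labellings pib) cardsE.
Qed.

(** Independence of the blocks: a labelling of [b] amounts to a family of labellings, one for each
    block of [pi], and each [F c] only sees the labels in [c]. *)
Lemma prod_sum_labellings (R : comPzSemiRingType) pi b
    (F : {set I} -> {ffun I -> J} -> R) : partition pi b ->
  (forall c (x y : {ffun I -> J}), {in c, x =1 y} -> F c x = F c y) ->
  \prod_(c in pi) \sum_(x : {ffun I -> J} | x \in labellings c) F c x
  = \sum_(x : {ffun I -> J} | x \in labellings b) \prod_(c in pi) F c x.
Proof.
move=> pib Fext; have /and3P[/eqP cov triv n0] := pib.
pose z : {ffun I -> J} := [ffun=> j0].
(* [h] assembles a family of block labellings and [h'] cuts a labelling into its blocks. The value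
   [z] off [pi] is the default required of the families produced by distributivity. *)
pose h (f : {ffun {set I} -> {ffun I -> J}}) : {ffun I -> J} :=
  [ffun i => if i \in b then f (pblock pi i) i else j0].
pose h' (x : {ffun I -> J}) : {ffun {set I} -> {ffun I -> J}} :=
  [ffun c => if c \in pi then [ffun i => if i \in c then x i else j0] else z].
rewrite (big_distr_big_dep z) (reindex_onto h' h) /=; last first.
  move=> f /pfamilyP[/subsetP sf fpi]; apply/ffunP => c; rewrite ffunE.
  case: ifPn => cpi; last first.
    by apply/esym/eqP; apply: contraNT cpi => ?; apply: sf.
  apply/ffunP => i; rewrite ffunE; case: ifPn => ic; last first.
    by have /labellingsP-> := fpi _ cpi.
  rewrite ffunE (def_pblock triv cpi ic) -cov.
  by rewrite (_ : i \in cover pi) //; apply/bigcupP; exists c.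
apply: eq_big => [x|x _]; last first.
  apply: eq_bigr => c cpi; apply: Fext => i ic.
  by rewrite ffunE cpi ffunE ic.
apply/andP/labellingsP => [[_ /eqP <-] i ib|xb].
  by rewrite ffunE (negPf ib).
split.
  apply/pfamilyP; split.
    by apply/subsetP => c; rewrite inE ffunE; case: ifPn => //; rewrite eqxx.
  move=> c cpi; apply/labellingsP => i ic.
  by rewrite ffunE cpi ffunE (negPf ic).
apply/eqP/ffunP => i; rewrite ffunE; case: ifPn => ib; last by rewrite xb.
by rewrite ffunE pblock_mem ?cov // ffunE mem_pblock cov ib.
Qed.

End Labellings.

(** * Fragmentation trees and their decomposition at the root *)

Section Trees.
Variable I : finType.
Implicit Types (A S t u v b c : {set I}) (T : {set {set I}}) (pi : {set {set I}}).

Definition trees k A : {set {set {set I}}} :=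
  [set T | is_fragtree A T && max_children k T].

(** When [c] is a vertex of the tree [T], this is T_{|c} without intersections; see
    [restr_subtree]. *)
Definition subtree T c : {set {set I}} := [set t in T | t \subset c].

Lemma is_fragtreeP A T :
  reflect [/\ A \in T,
              {in T, forall t, t \subset A},
              {in T, forall t, t != set0},
              {in A, forall i, [set i] \in T} &
              {in T &, forall t u, [|| [disjoint t & u], t \subset u | u \subset t]}]
          (is_fragtree A T).
Proof.
apply: (iffP and5P) => [[AT TA T0 T1 TT]|[AT TA T0 T1 TT]]; split=> //.
- by move=> t /(subsetP TA); rewrite inE.
- by move=> t tT; apply: contraNneq T0 => <-.
- by move=> i iA; have /forall_inP := T1; apply.
- by move=> t u tT uT; have /forall_inP/(_ t tT)/forall_inP := TT; apply.
- by apply/subsetP => t tT; rewrite inE TA.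
- by apply/negP => /T0; rewrite eqxx.
- by apply/forall_inP.
- by apply/forall_inP => t tT; apply/forall_inP => u uT; apply: TT.
Qed.

Lemma mem_subtree T c t : (t \in subtree T c) = (t \in T) && (t \subset c).
Proof. by rewrite inE. Qed.

Lemma childrenP T u t :
  reflect [/\ t \in T, u \in T, t \proper u &
              {in T, forall v, t \proper v -> u \subset v}]
          (t \in children T u).
Proof.
rewrite inE; apply: (iffP andP) => [[tT /and3P[uT tu h]]|[tT uT tu h]]; split=> //.
  by move=> v vT; move/forall_inP/(_ v vT)/implyP : h; apply.
by apply/and3P; split=> //; apply/forall_inP => v vT; apply/implyP/h.
Qed.

Lemma is_fragtree_restr A T S : is_fragtree A T -> S \subset A -> S != set0 ->
  is_fragtree S (restr T S).
Proof.
move=> /is_fragtreeP[AT TA T0 T1 TT] SA S0; apply/is_fragtreeP.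
split.
- by rewrite in_setD1 S0; apply/imsetP; exists A => //; rewrite (setIidPr SA).
- by move=> t; rewrite in_setD1 => /andP[_ /imsetP[u _ ->]]; exact: subsetIr.
- by move=> t; rewrite in_setD1 => /andP[].
- move=> i iS; rewrite in_setD1 -card_gt0 cards1; apply/imsetP; exists [set i].
    by apply: T1; exact: (subsetP SA).
  by apply/esym/setIidPl; rewrite sub1set.
- move=> _ _ /setD1P[_ /imsetP[t tT ->]] /setD1P[_ /imsetP[u uT ->]].
  have /or3P[tu|tu|ut] := TT t u tT uT.
  + by rewrite (disjointWl (subsetIl _ _)) // (disjointWr (subsetIl _ _)).
  + by rewrite (setSI S tu) orbT.
  + by rewrite (setSI S ut) !orbT.
Qed.

(** A vertex is disjoint from [c], inside [c], or contains [c]; its trace on [c] is then empty,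
    itself, or [c], and [c] is a vertex already. *)
Lemma restr_subtree A T c : is_fragtree A T -> c \in T ->
  restr T c = subtree T c.
Proof.
move=> /is_fragtreeP[AT TA T0 T1 TT] cT; apply/setP => t.
rewrite mem_subtree; apply/setD1P/andP => [[t0 /imsetP[u uT tE]]|[tT tc]].
  have /or3P[uc|uc|cu] := TT u c uT cT.
  - by move: t0; rewrite tE setI_eq0 uc.
  - by rewrite tE (setIidPl uc).
  - by rewrite tE (setIidPr cu).
by split; [exact: T0|apply/imsetP; exists t => //; apply/esym/setIidPl].
Qed.

Lemma is_fragtree_subtree A T c : is_fragtree A T -> c \in T ->
  is_fragtree c (subtree T c).
Proof.
move=> TA cT; rewrite -(restr_subtree TA cT); apply: is_fragtree_restr (TA) _ _.
  by have /is_fragtreeP[_ -> //] := TA.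
by have /is_fragtreeP[_ _ -> //] := TA.
Qed.

(** A vertex strictly above a vertex [t] inside [c] meets [c], so it lies in [c] or contains [c],
    hence [b]. Vertices outside the subtree therefore cannot affect which vertices have parent
    [b]. *)
Lemma children_subtree A T c b : is_fragtree A T -> c \in T -> b \in T ->
  b \subset c -> children (subtree T c) b = children T b.
Proof.
move=> /is_fragtreeP[AT TA T0 T1 TT] cT bT bc; apply/setP => t.
apply/childrenP/childrenP; rewrite !mem_subtree.
- move=> [/andP[tT tc] _ tb h]; split=> // v vT tv.
  have /or3P[vc|vc|cv] := TT v c vT cT.
  + have /set0Pn[i it] := T0 t tT.
    move: vc; rewrite disjoint_subset => /subsetP/(_ i).
    by rewrite (subsetP (proper_sub tv)) // inE (subsetP tc) // => /(_ isT).
  + by apply: h; rewrite ?mem_subtree ?vT.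
  + exact: subset_trans cv.
- move=> [tT _ tb h]; split=> //; rewrite ?tT ?bT //=.
    exact: subset_trans (proper_sub tb) bc.
  by move=> v; rewrite mem_subtree => /andP[vT _]; exact: h.
Qed.

Lemma partition_children A T : is_fragtree A T -> (2 <= #|A|)%N ->
  partition (children T A) A.
Proof.
move=> /is_fragtreeP[AT TA T0 T1 TT] A2; apply/and3P; split.
- rewrite eqEsubset; apply/andP; split; apply/subsetP => i.
    by move=> /bigcupP[t /childrenP[_ _ /proper_sub/subsetP tA _]]; exact: tA.
  (* The block of [i] is a largest vertex containing [i] other than the root; the singleton of [i]
     is a candidate because [A] has two elements. *)
  move=> iA; pose P t := [&& t \in T, i \in t & t \proper A].
  have P1 : P [set i].
    by rewrite /P T1 // set11 properEcard sub1set iA cards1.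
  case: (arg_maxnP (fun t : {set I} => #|t|) P1) => t /and3P[tT it tA] tmax.
  apply/bigcupP; exists t => //; apply/childrenP; split=> // v vT tv.
  apply: contraLR (proper_card tv) => Av; rewrite -leqNgt; apply: tmax.
  by rewrite /P vT properE (TA v vT) Av (subsetP (proper_sub tv)).
- apply/trivIsetP => t u /childrenP[tT _ tA ht] /childrenP[uT _ uA hu] tu.
  have /or3P[//|tsu|ust] := TT t u tT uT.
    have := ht u uT; rewrite properEneq tu tsu => /(_ isT) Au.
    by move: uA; rewrite properE Au andbF.
  have := hu t tT; rewrite properEneq eq_sym tu ust => /(_ isT) At.
  by move: tA; rewrite properE At andbF.
- by apply/negP => /childrenP[/T0]; rewrite eqxx.
Qed.

Lemma card_children_gt1 A T : is_fragtree A T -> (2 <= #|A|)%N ->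
  (2 <= #|children T A|)%N.
Proof.
move=> TA A2; have pA := partition_children TA A2.
have /and3P[/eqP cov _ _] := pA.
have A0 : A != set0 by rewrite -card_gt0 (ltn_trans _ A2).
rewrite ltn_neqAle eq_sym; apply/andP; split; last first.
  rewrite card_gt0; apply: contraNneq A0 => c0.
  by rewrite -cov c0 /cover big_set0.
apply/negP => /cards1P[B cB].
have /childrenP[_ _] : B \in children T A by rewrite cB set11.
by rewrite -cov cB /cover big_set1 properxx.
Qed.

(** A vertex other than the root meets some child [c] of the root. It cannot strictly contain [c],
    whose parent is [A], so it lies inside [c]. *)
Lemma subtree_children A T : is_fragtree A T -> (2 <= #|A|)%N ->
  T = A |: \bigcup_(c in children T A) subtree T c.
Proof.
move=> fT A2; have /and3P[/eqP cov _ _] := partition_children fT A2.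
have /is_fragtreeP[AT TA T0 T1 TT] := fT.
apply/setP => t; apply/idP/setU1P => [tT|[->//|/bigcupP[c _]]]; last first.
  by rewrite mem_subtree => /andP[].
have [->|tA] := eqVneq t A; [by left|right].
have /set0Pn[i it] := T0 t tT.
have : i \in cover (children T A) by rewrite cov (subsetP (TA t tT)).
move=> /bigcupP[c cA ic]; apply/bigcupP; exists c => //.
have /childrenP[cT _ cpA hc] := cA.
rewrite mem_subtree tT; have [//|ct] := boolP (t \subset c).
have /or3P[/pred0Pn[]|tc|ct'] := TT t c tT cT.
- by exists i; rewrite /= it ic.
- by rewrite tc in ct.
- have := hc t tT; rewrite properE ct' ct => /(_ isT) At.
  by case/eqP: tA; apply/eqP; rewrite eqEsubset At TA.
Qed.

Lemma proper_block A pi : partition pi A -> (2 <= #|pi|)%N ->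
  {in pi, forall c, c \proper A}.
Proof.
move=> piA pi2 c cpi; have /and3P[/eqP cov triv n0] := piA.
have cA : c \subset A by rewrite -cov; apply: (bigcup_max c).
rewrite properEneq cA andbT; apply: contraTneq pi2 => cE.
rewrite -leqNgt -(cards1 c) subset_leq_card //; apply/subsetP => d dpi.
rewrite inE; apply: contraNT n0 => dc.
have := trivIsetP triv d c dpi cpi dc.
rewrite -setI_eq0 (setIidPl _) => [/eqP <- //|].
by rewrite cE -cov; apply: (bigcup_max d).
Qed.

(** * Gluing trees on the blocks of a partition under a common root *)

Section Glue.
Variables (A : {set I}) (pi : {set {set I}}) (f : {set I} -> {set {set I}}).
Hypotheses (piA : partition pi A) (pi2 : (2 <= #|pi|)%N).
Hypothesis ft : {in pi, forall c, is_fragtree c (f c)}.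

Definition glue := A |: \bigcup_(c in pi) f c.

Let block_sub := proper_block piA pi2.

Let block_eq c d t : c \in pi -> d \in pi -> t != set0 -> t \subset c ->
  t \subset d -> c = d.
Proof.
move=> cpi dpi /set0Pn[i it] /subsetP tc /subsetP td.
have /and3P[_ triv _] := piA.
by rewrite -(def_pblock triv cpi (tc i it)) (def_pblock triv dpi (td i it)).
Qed.

Let glueP t : t \in glue -> t = A \/ exists2 c, c \in pi & t \in f c.
Proof. by move=> /setU1P[->|/bigcupP[c ? ?]]; [left|right; exists c]. Qed.

Let mem_glue c t : c \in pi -> t \in f c -> t \in glue.
Proof. by move=> cpi tf; apply/setU1P; right; apply/bigcupP; exists c. Qed.

Lemma subtree_glue c : c \in pi -> subtree glue c = f c.
Proof.
move=> cpi; apply/setP => t; rewrite mem_subtree; apply/andP/idP; last first.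
  move=> tf; split; first exact: mem_glue tf.
  by have /is_fragtreeP[_ -> //] := ft cpi.
move=> [/glueP[->|[d dpi tf]] tc].
  by have := block_sub cpi; rewrite properE tc andbF.
have /is_fragtreeP[_ tsub tn0 _ _] := ft dpi.
by rewrite (block_eq cpi dpi (tn0 t tf) tc (tsub t tf)).
Qed.

Lemma is_fragtree_glue : is_fragtree A glue.
Proof.
have /and3P[/eqP cov triv n0] := piA.
apply/is_fragtreeP; split.
- exact: setU11.
- move=> t /glueP[->//|[c cpi tf]].
  have /is_fragtreeP[_ tsub _ _ _] := ft cpi.
  exact: subset_trans (tsub t tf) (proper_sub (block_sub cpi)).
- move=> t /glueP[->|[c cpi tf]]; last by have /is_fragtreeP[_ _ ->] := ft cpi.
  have /card_gt0P[c cpi] : (0 < #|pi|)%N by exact: ltn_trans pi2.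
  by rewrite -proper0 (sub_proper_trans (sub0set c)) // block_sub.
- move=> i; rewrite -cov => /bigcupP[c cpi ic]; apply: (mem_glue cpi).
  by have /is_fragtreeP[_ _ _ ->] := ft cpi.
- have sA t : t \in glue -> t \subset A.
    move=> /glueP[->//|[c cpi tf]].
    have /is_fragtreeP[_ tsub _ _ _] := ft cpi.
    exact: subset_trans (tsub t tf) (proper_sub (block_sub cpi)).
  move=> t u tT uT.
  have [->|[c cpi tf]] := glueP tT; first by rewrite (sA u uT) !orbT.
  have [->|[d dpi uf]] := glueP uT; first by rewrite (sA t tT) !orbT.
  have /is_fragtreeP[_ tsub _ _ tt] := ft cpi.
  have /is_fragtreeP[_ usub _ _ _] := ft dpi.
  have [cd|cd] := eqVneq c d; first by rewrite tt // cd.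
  apply/orP; left; apply: disjointWl (tsub t tf) _.
  by apply: disjointWr (usub u uf) _; exact: (trivIsetP triv).
Qed.

Lemma children_glue_root : children glue A = pi.
Proof.
apply/setP => t; apply/childrenP/idP => [[tT _ tA ht]|tpi].
  have [tE|[c cpi tf]] := glueP tT; first by rewrite tE properxx in tA.
  have /is_fragtreeP[cf tsub _ _ _] := ft cpi.
  have [-> //|tc] := eqVneq t c.
  have := ht c (mem_glue cpi cf); rewrite properEneq tc tsub // => /(_ isT) Ac.
  by have := block_sub cpi; rewrite properE Ac andbF.
have /is_fragtreeP[tf _ tn0 _ _] := ft tpi.
split; [exact: mem_glue tf|exact: setU11|exact: block_sub|].
move=> v /glueP[->//|[c cpi vf]] tv.
have /is_fragtreeP[_ vsub _ _ _] := ft cpi.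
have tc := block_eq tpi cpi (tn0 t tf) (subxx _)
  (subset_trans (proper_sub tv) (vsub v vf)).
by move: tv; rewrite properE tc (vsub v vf) andbF.
Qed.

Lemma children_glue c b : c \in pi -> b \in f c ->
  children glue b = children (f c) b.
Proof.
move=> cpi bf; have /is_fragtreeP[cf bsub _ _ _] := ft cpi.
rewrite -(subtree_glue cpi) (children_subtree is_fragtree_glue) ?bsub //.
- exact: mem_glue cf.
- exact: mem_glue bf.
Qed.

Lemma max_children_glue k : (#|pi| <= k)%N ->
  {in pi, forall c, max_children k (f c)} -> max_children k glue.
Proof.
move=> pik fk; apply/forall_inP => b /glueP[->|[c cpi bf]].
  by rewrite children_glue_root.
by rewrite (children_glue cpi bf); have /forall_inP := fk c cpi; apply.
Qed.

(** Each vertex other than the root lies in [f c] for exactly one block [c], and has the same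
    children in [f c] as in the glued tree. *)
Lemma prod_glue (R : comPzSemiRingType) (q : {set I} -> {set {set I}} -> R) :
  (2 <= #|A|)%N ->
  \prod_(b in glue | (2 <= #|b|)%N) q b (children glue b)
  = q A pi *
    \prod_(c in pi) \prod_(b in f c | (2 <= #|b|)%N) q b (children (f c) b).
Proof.
move=> A2; rewrite (bigD1 A) /=; last by rewrite setU11.
rewrite children_glue_root; congr (_ * _).
under [RHS]eq_bigr => c cpi.
  under eq_bigr => b /andP[bf _] do rewrite -(children_glue cpi bf).
  over.
rewrite (exchange_big_dep
  (fun b => [&& b \in glue, (2 <= #|b|)%N & b != A])) /=; last first.
  move=> c b cpi /andP[bf ->]; rewrite (mem_glue cpi bf) /=.
  apply: contraTneq (block_sub cpi) => <-.
  have /is_fragtreeP[_ bsub _ _ _] := ft cpi.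
  by rewrite properE (bsub b bf) andbF.
rewrite [LHS](eq_bigl (fun b => [&& b \in glue, (2 <= #|b|)%N & b != A])).
  2: by move=> b; rewrite andbA.
apply: eq_bigr => b /and3P[bT b2 bA].
have [bE|[c cpi bf]] := glueP bT; first by rewrite bE eqxx in bA.
rewrite (big_pred1 c) // => d; rewrite b2 andbT /=.
apply/andP/eqP => [[dpi bfd]|->//].
have /is_fragtreeP[_ bsub bn0 _ _] := ft cpi.
have /is_fragtreeP[_ bsubd _ _ _] := ft dpi.
exact: block_eq dpi cpi (bn0 b bf) (bsubd b bfd) (bsub b bf).
Qed.

End Glue.

(** The weights are those of a tree grown from the root: split [A] according to [q A], then grow
    independent trees on the blocks. The blocks are smaller than [A], so induction on the size of
    [A] gives total mass 1. *)
Lemma sum_trees (R : comPzSemiRingType) (k : nat)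
    (q : {set I} -> {set {set I}} -> R) :
  (forall b, (2 <= #|b|)%N ->
     \sum_(pi | [&& partition pi b, (2 <= #|pi|)%N & (#|pi| <= k)%N]) q b pi = 1) ->
  forall A, A != set0 ->
  \sum_(T in trees k A) \prod_(b in T | (2 <= #|b|)%N) q b (children T b) = 1.
Proof.
move=> q1 A; have [m Am] := ubnP #|A|; elim: m A Am => // m IH A Am A0.
have [A2|A1] := leqP 2 #|A|; last first.
  have {A1}/cards1P[i AE] : #|A| == 1%N by rewrite eqn_leq card_gt0 A0 -ltnS A1.
  have cA : children [set A] A = set0.
    apply/setP => t; rewrite [RHS]inE; apply/negP => /childrenP[].
    by rewrite inE => /eqP->; rewrite properxx.
  rewrite (big_pred1 [set A]) => [|T].
    rewrite big1 // => b /andP[]; rewrite inE => /eqP->.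
    by rewrite AE cards1.
  rewrite inE; apply/andP/eqP => [[/is_fragtreeP[AT TA T0 _ _] _]|->].
    apply/setP => t; rewrite inE; apply/idP/eqP => [tT|->//].
    have := TA t tT; rewrite AE subset1 => /orP[/eqP//|].
    by rewrite (negPf (T0 t tT)).
  split; last by apply/forall_inP => t /set1P->; rewrite cA cards0.
  apply/is_fragtreeP; split.
  - exact: set11.
  - by move=> t /set1P->.
  - by move=> t /set1P->.
  - by move=> j; rewrite AE => /set1P->; rewrite set11.
  - by move=> t u /set1P-> /set1P->; rewrite subxx !orbT.
rewrite (partition_big (fun T : {set {set I}} => children T A)
  (fun pi => [&& partition pi A, (2 <= #|pi|)%N & (#|pi| <= k)%N])) /=; last first.
  move=> T; rewrite inE => /andP[fT kT].
  rewrite partition_children // card_children_gt1 //=.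
  by have /forall_inP := kT; apply; have /is_fragtreeP[] := fT.
rewrite -[RHS](q1 A A2); apply: eq_bigr => pi /and3P[piA pi2 pik].
(* For a fixed root partition [pi], gluing and taking subtrees are inverse bijections between trees
   and families of trees on the blocks; [set0] is the default off [pi]. *)
pose h (f : {ffun {set I} -> {set {set I}}}) := glue A pi f.
pose h' T : {ffun {set I} -> {set {set I}}} :=
  [ffun c => if c \in pi then subtree T c else set0].
rewrite (reindex_onto h h') /=; last first.
  move=> T /andP[]; rewrite inE => /andP[fT _] /eqP cT.
  rewrite /h /glue [RHS](subtree_children fT A2) cT; congr (_ |: _).
  by apply: eq_bigr => c cpi; rewrite ffunE cpi.
transitivity (q A pi * \prod_(c in pi) \sum_(T in trees k c)
    \prod_(b in T | (2 <= #|b|)%N) q b (children T b)).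
  rewrite (big_distr_big_dep set0) /= big_distrr /=; apply: eq_big => f.
    apply/idP/pfamilyP => [|[/subsetP sf fpi]].
      rewrite inE => /andP[/andP[/andP[fT kT] /eqP cT] /eqP hf].
      split.
        apply/subsetP => c; rewrite inE -hf ffunE.
        by case: ifP => //; rewrite eqxx.
      move=> c cpi; rewrite -hf ffunE cpi inE.
      have /childrenP[cT' _ _ _] : c \in children (h f) A by rewrite cT.
      rewrite (is_fragtree_subtree fT) //=.
      apply/forall_inP => b; rewrite mem_subtree => /andP[bT bc].
      by rewrite (children_subtree fT) //; have /forall_inP := kT; apply.
    have ft : {in pi, forall c, is_fragtree c (f c)}.
      by move=> c /fpi; rewrite inE => /andP[].
    rewrite inE /h is_fragtree_glue // children_glue_root // eqxx andbT.
    rewrite max_children_glue //=; last by move=> c /fpi; rewrite inE => /andP[].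
    apply/eqP/ffunP => c; rewrite ffunE; case: ifPn => cpi.
      by rewrite subtree_glue.
    by apply/esym/eqP; apply: contraNT cpi => ?; exact: sf.
  rewrite inE => /andP[/andP[/andP[fT kT] /eqP cT] /eqP hf].
  have ft : {in pi, forall c, is_fragtree c (f c)}.
    move=> c cpi; rewrite -hf ffunE cpi; apply: is_fragtree_subtree fT _.
    by have /childrenP[] : c \in children (h f) A by rewrite cT.
  by rewrite /h prod_glue.
rewrite big1 ?mulr1 // => c cpi.
have /and3P[/eqP cov _ n0] := piA.
apply: IH; last by apply: contraNneq n0 => <-.
rewrite -ltnS (leq_trans _ Am) // ltnS; apply: proper_card.
exact: proper_block cpi.
Qed.

End Trees.

(** * Total mass of the cut-and-paste transition, two-block partitions and binary trees *)

Section CutAndPasteSum.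
Variables (I J : finType) (R : numFieldType).
Implicit Types (b c : {set I}) (pi sigma : {set {set I}}).

(** The factor in front counts the labellings inducing [pi'], so the sum runs over labellings of [b]
    and factorises over the blocks of [pi]. *)
Lemma sum_cut_and_paste (w : {set I} -> {set {set I}} -> R) pi b :
  (0 < #|J|)%N -> partition pi b ->
  {in pi, forall c,
    \sum_(sigma | partition sigma c && (#|sigma| <= #|J|)%N) w c sigma = 1} ->
  \sum_(pi' | partition pi' b && (#|pi'| <= #|J|)%N)
     #|J|`!%:R / (#|J| - #|pi'|)`!%:R *
     \prod_(c in pi) ((#|J| - #|restr pi' c|)`!%:R / #|J|`!%:R
                      * w c (restr pi' c)) = 1.
Proof.
move=> /card_gt0P[j0 _] pib w1; have /and3P[/eqP cov triv n0] := pib.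
have fact0 m : m`!%:R != 0 :> R by rewrite pnatr_eq0 -lt0n fact_gt0.
have ffactE m : (m <= #|J|)%N ->
    (#|J| ^_ m)%:R = #|J|`!%:R / (#|J| - m)`!%:R :> R.
  by move=> mJ; rewrite -(ffact_fact mJ) natrM mulfK.
pose H c sigma : R := (#|J| - #|sigma|)`!%:R / #|J|`!%:R * w c sigma.
transitivity (\sum_(pi' | partition pi' b && (#|pi'| <= #|J|)%N)
    (\prod_(c in pi) H c (restr pi' c)) *+ (#|J| ^_ #|pi'|)).
  by apply: eq_bigr => pi' /andP[_ le]; rewrite -[RHS]mulr_natl ffactE.
rewrite -(sum_preim_partition j0 b (fun pi' => \prod_(c in pi) H c (restr pi' c))).
under eq_bigr => x _.
  under eq_bigr => c cpi.
    rewrite restr_preim_partition; last by rewrite -cov (bigcup_max c).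
    over.
  over.
rewrite -(prod_sum_labellings (F := fun c x => H c (preim_partition x c)) j0 pib);
  last by move=> c x y xy; rewrite (eq_preim_partition xy).
(* On one block, going back from labellings to partitions produces a falling factorial that cancels
   the factorial ratio in [H]. *)
rewrite big1 // => c cpi; rewrite sum_preim_partition -[RHS](w1 c cpi).
apply: eq_bigr => sigma /andP[_ le].
rewrite -[LHS]mulr_natl ffactE // /H mulrA mulrA mulfVK //.
by rewrite mulfV // mul1r.
Qed.

Lemma sum_restr_preim_partition (V : nmodType) (g : {ffun I -> J} -> V) c :
  \sum_(sigma | partition sigma c && (#|sigma| <= #|J|)%N)
    \sum_(x : {ffun I -> J} | restr (preim_partition x [set: I]) c == sigma) g x
  = \sum_(x : {ffun I -> J}) g x.
Proof.
rewrite [RHS](partition_big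
  (fun x : {ffun I -> J} => restr (preim_partition x [set: I]) c)
  (fun sigma => partition sigma c && (#|sigma| <= #|J|)%N)) //= => x _.
by rewrite restr_preim_partition ?subsetT // preim_partitionP card_preim_partition.
Qed.

(** Only two labels occur, also outside [b], so that the i.i.d. probability of this labelling
    involves just two masses of the paintbox. *)
Lemma two_block_labelling (j0 j1 : J) pi b : j0 != j1 -> partition pi b ->
  #|pi| = 2%N ->
  exists2 x : {ffun I -> J}, forall i, x i \in [:: j0; j1] &
                              preim_partition x b = pi.
Proof.
move=> j01 pib /eqP/cards2P[B [C [BC piE]]].
have /and3P[/eqP cov triv n0] := pib.
exists [ffun i => if i \in B then j0 else j1].
  by move=> i; rewrite ffunE; case: ifP; rewrite !inE eqxx ?orbT.
apply/eqP/(eq_preim_partitionP _ pib) => i j ib jb; rewrite !ffunE.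
have blk l : l \in b -> pblock pi l = if l \in B then B else C.
  move=> lb; case: ifPn => lB; apply: def_pblock => //; rewrite ?piE ?set21 ?set22 //.
  move: lb; rewrite -cov => /bigcupP[D].
  by rewrite piE => /set2P[]-> //; rewrite (negPf lB).
rewrite !blk //; do 2!case: ifP => _; rewrite ?eqxx //.
  by rewrite (negPf j01) (negPf BC).
by rewrite eq_sym (negPf j01) eq_sym (negPf BC).
Qed.

Lemma exists_two_block_partition b : (2 <= #|b|)%N ->
  exists2 pi, partition pi b & #|pi| = 2%N.
Proof.
move=> /card_gt1P[i [j [ib jb ij]]].
exists (preim_partition (pred1 i) b); first exact: preim_partitionP.
apply/eqP; rewrite eqn_leq -{1}card_bool card_preim_partition /=.
have /and3P[/eqP cov _ _] := preim_partitionP (pred1 i) b.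
apply/card_gt1P; exists (pblock (preim_partition (pred1 i) b) i).
exists (pblock (preim_partition (pred1 i) b) j).
rewrite !pblock_mem ?cov // pblock_preim_partition //= eqxx.
by move: ij; rewrite eq_sym => /negPf->.
Qed.

Lemma partition_one_block b : b != set0 -> partition [set b] b.
Proof.
move=> b0; apply/and3P; split; first by rewrite /cover big_set1.
  by apply/trivIsetP => B C /set1P-> /set1P->; rewrite eqxx.
by rewrite inE eq_sym.
Qed.

Lemma partition_card_lt2 pi b : b != set0 -> partition pi b ->
  (#|pi| < 2)%N = (pi == [set b]).
Proof.
move=> b0 /and3P[/eqP cov _ _]; apply/idP/eqP => [|->]; last by rewrite cards1.
rewrite ltnS leq_eqVlt ltnS leqn0 cards_eq0 => /orP[/cards1P[B piE]|/eqP piE].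
  by rewrite -cov piE /cover big_set1.
by case/eqP: b0; rewrite -cov piE /cover big_set0.
Qed.

(* The random tree that splits every block into two prescribed parts is a
   special case of [sum_trees], so some tree of positive weight exists. *)
Lemma exists_binary_tree k A : (2 <= k)%N -> A != set0 ->
  exists2 T : {set {set I}}, T \in trees k A &
    {in T, forall b, (2 <= #|b|)%N -> #|children T b| = 2%N}.
Proof.
move=> k2 A0.
pose half b := odflt set0 [pick pi | partition pi b && (#|pi| == 2%N)].
have halfP b : (2 <= #|b|)%N -> partition (half b) b /\ #|half b| = 2%N.
  move=> /exists_two_block_partition[pi pib pi2]; rewrite /half.
  by case: pickP => [? /andP[? /eqP]|/(_ pi)] //=; rewrite pib pi2.
have : \sum_(T in trees k A)
    \prod_(b in T | (2 <= #|b|)%N) (children T b == half b)%:R = 1 :> int.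
  apply: (sum_trees (q := fun b pi => (pi == half b)%:R)) => // b b2.
  have [hb h2] := halfP b b2.
  rewrite (bigD1 (half b)) /= ?hb ?h2 // eqxx big1 ?addr0 // => pi.
  by case/andP => _ /negPf->.
have [[T TA Tb] _|noT] :=
    altP (@exists_inP _ (mem (trees k A))
      (fun T => [forall b in T, (2 <= #|b|)%N ==> (children T b == half b)])).
  exists T => // b bT b2; have [_ <-] := halfP b b2.
  by have /forall_inP/(_ b bT)/implyP/(_ b2)/eqP-> := Tb.
rewrite big1 // => T TA; move: noT; rewrite negb_exists_in.
move=> /forall_inP/(_ T TA); rewrite negb_forall_in => /exists_inP[b bT].
rewrite negb_imply => /andP[b2 /negPf hb].
by rewrite (bigD1 b) ?bT //= hb mul0r.
Qed.

End CutAndPasteSum.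

From mathcomp Require Import all_classical all_reals all_analysis.

Import numFieldNormedType.Exports.

(** * Stationary laws of a finite Markov chain *)

Section FiniteMarkovChain.
Variables (R : realType) (E : finType) (Q : E -> E -> R).
Hypothesis Q_ge0 : forall x y, 0 <= Q x y.
Hypothesis Q_sum1 : forall x, \sum_y Q x y = 1.

(** As the rows of [Q] sum to 1, [Q] minus the identity kills the constant column vector; it is
    singular and so also has a non-zero left null vector. *)
Lemma exists_invariant_vector : (0 < #|E|)%N ->
  exists2 v : {ffun E -> R}, v != [ffun=> 0] & forall y, \sum_x v x * Q x y = v y.
Proof.
move=> /card_gt0P[x0 _].
have sumE (F : E -> R) : \sum_y F y = \sum_(i < #|E|) F (enum_val i).
  by rewrite (reindex _ (onW_bij _ (@enum_val_bij E))).
pose M : 'M[R]_#|E| := \matrix_(i, j) (Q (enum_val i) (enum_val j) - (i == j)%:R).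
have : \det M = 0.
  (* [det0P] speaks of row vectors, so the constant vector is used on the transpose. *)
  rewrite -det_tr; apply/eqP/det0P; exists (const_mx 1).
    apply/eqP => /matrixP/(_ ord0 (enum_rank x0)); rewrite !mxE => /eqP.
    by rewrite oner_eq0.
  apply/matrixP => i j; rewrite !mxE.
  under eq_bigr => l _ do rewrite !mxE mul1r.
  rewrite sumrB -(sumE (Q (enum_val j))) Q_sum1.
  rewrite (bigD1 j) //= eqxx big1 ?addr0 ?subrr // => l /negPf lj.
  by rewrite eq_sym lj.
move/eqP/det0P => [v v0 vM]; exists [ffun x => v 0 (enum_rank x)].
  apply: contra_neq v0 => v0; apply/matrixP => i j; rewrite mxE (ord1 i).
  by have := congr1 (fun h : {ffun E -> R} => h (enum_val j)) v0;
    rewrite !ffunE enum_valK.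
move=> y; rewrite ffunE.
have := congr1 (fun h : 'rV[R]_#|E| => h 0 (enum_rank y)) vM; rewrite !mxE.
under eq_bigr => i _ do rewrite mxE mulrBr.
rewrite sumrB => /eqP; rewrite subr_eq0 => /eqP.
rewrite [X in _ = X](bigD1 (enum_rank y)) //= eqxx mulr1.
rewrite [X in _ = _ + X]big1 ?addr0; last first.
  by move=> i /negPf ->; rewrite mulr0.
move=> <-; rewrite sumE; apply: eq_bigr => i _.
by rewrite ffunE enum_valK enum_rankK.
Qed.

(* Summing the triangle inequality over [y] gives an equality since the rows
   of [Q] sum to 1, so there is equality for each [y]. *)
Lemma invariant_norm (v : {ffun E -> R}) :
  (forall y, \sum_x v x * Q x y = v y) ->
  forall y, \sum_x `|v x| * Q x y = `|v y|.
Proof.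
move=> vQ y.
have le z : `|v z| <= \sum_x `|v x| * Q x z.
  rewrite -vQ (le_trans (ler_norm_sum _ _ _)) // ler_sum // => x _.
  by rewrite normrM (ger0_norm (Q_ge0 _ _)).
have [_] := leif_sum (P := predT) (fun z _ => leif_eq (le z)).
rewrite [X in _ == X]exchange_big /=.
under [X in (_ == X)]eq_bigr => x _ do rewrite -mulr_sumr Q_sum1 mulr1.
by rewrite eqxx => /esym/forall_inP/(_ y isT)/eqP.
Qed.

Lemma exists_stationary_distribution : (0 < #|E|)%N ->
  exists rho : {ffun E -> R}, is_distribution rho /\ is_stationary Q rho.
Proof.
move=> /exists_invariant_vector[v v0 vQ].
have nvQ := invariant_norm vQ.
have S0 : 0 < \sum_x `|v x|.
  rewrite lt_neqAle sumr_ge0 // andbT eq_sym psumr_neq0 //.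
  apply: contraNT v0 => /hasPn nv; apply/eqP/ffunP => x; rewrite ffunE.
  have := nv x (mem_index_enum x); rewrite /= -leNgt normr_le0.
  by move=> /eqP.
exists [ffun x => `|v x| / \sum_x `|v x|]; split; first split.
- by move=> x; rewrite ffunE divr_ge0 // ltW.
- under eq_bigr => x _ do rewrite ffunE.
  by rewrite -mulr_suml mulfV // gt_eqF.
- move=> y; rewrite ffunE -nvQ mulr_suml; apply: eq_bigr => x _.
  by rewrite ffunE mulrAC.
Qed.

(** The difference [d] of the two laws is invariant and, up to exchanging them, non-negative at
    [y0]. Positivity of the column [y0] spreads this sign to all states, and [d] has total mass
    0. *)
Lemma unique_stationary_distribution (y0 : E) (rho sigma : {ffun E -> R}) :
  (forall x, 0 < Q x y0) ->
  is_distribution rho -> is_stationary Q rho ->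
  is_distribution sigma -> is_stationary Q sigma -> rho = sigma.
Proof.
move=> Qy0 [_ rho1] rhoQ [_ sigma1] sigmaQ.
wlog le0 : rho sigma rho1 rhoQ sigma1 sigmaQ / sigma y0 <= rho y0.
  by move=> th; have [/th|/ltW/th] := leP (sigma y0) (rho y0); move=> -> //.
pose d : {ffun E -> R} := [ffun x => rho x - sigma x].
have dQ y : \sum_x d x * Q x y = d y.
  rewrite [RHS]ffunE -rhoQ -sigmaQ -sumrB; apply: eq_bigr => x _.
  by rewrite ffunE mulrBl.
have d_ge0 x : 0 <= d x.
  (* Both [d] and its absolute value are invariant, and they agree at [y0]; the terms of this sum
     are non-negative, so each vanishes. *)
  have : \sum_x (`|d x| - d x) * Q x y0 = 0.
    under eq_bigr do rewrite mulrBl.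
    by rewrite sumrB invariant_norm // dQ ger0_norm ?subrr // ffunE subr_ge0.
  move/eqP; rewrite psumr_eq0 => [/allP/(_ x (mem_index_enum x))|z _]; last first.
    by rewrite mulr_ge0 // subr_ge0 ler_norm.
  by rewrite /= mulf_eq0 (gt_eqF (Qy0 x)) orbF subr_eq0 => /eqP <-.
have : \sum_x d x = 0.
  by under eq_bigr do rewrite ffunE; rewrite sumrB rho1 sigma1 subrr.
move/eqP; rewrite psumr_eq0 // => /allP d0; apply/ffunP => x.
apply/eqP; rewrite -subr_eq0.
by have := d0 x (mem_index_enum x); rewrite /= ffunE.
Qed.

End FiniteMarkovChain.

(** If the integral were 0, the non-negative [f] would vanish almost everywhere on [D]. *)
Lemma Rintegral_gt0 d (T : measurableType d) (R : realType)
    (mu : {measure set T -> \bar R}) (D : set T) (f : T -> R) :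
  measurable D -> mu.-integrable D (EFin \o f) -> (forall x, D x -> 0 <= f x) ->
  ~ mu.-negligible (D `&` [set x | 0 < f x])%classic ->
  0 < \int[mu]_(x in D) f x.
Proof.
move=> mD intf f0 fN; rewrite lt_neqAle Rintegral_ge0 // andbT eq_sym.
apply/eqP => if0; apply: fN.
have : (\int[mu]_(x in D) `|(EFin \o f) x| = 0)%E.
  rewrite (eq_integral (EFin \o f)) => [|x].
    rewrite -(fineK (integrable_fin_num mD intf)); congr EFin; exact: if0.
  by rewrite inE => Dx; rewrite /= ger0_norm // f0.
move/(ae_eq_integral_abs _ mD (measurable_int _ intf)).
apply: negligibleS => x [Dx fx] /= /(_ Dx) [fx0].
by move: fx; rewrite /= fx0 ltxx.
Qed.

(** * Paintbox probabilities: measurability, total mass and positivity *)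

Section Paintbox.
Variables (R : realType) (k n : nat).
Notation seqk := (k.-tuple (measurableTypeR R)).
Implicit Types (s : seqk) (c b : {set 'I_n}) (sigma pi : {set {set 'I_n}}).

Lemma measurable_mass_partitions : measurable (mass_partitions R k).
Proof.
have mt (i : 'I_k) : measurable_fun [set: seqk] (fun s => tnth s i : R).
  exact: measurable_tnth.
pose A := (\bigcap_(p in [set p : 'I_k * 'I_k | (p.1 <= p.2)%N])
             [set s : seqk | (tnth s p.2 <= tnth s p.1 :> R)%R])%classic.
pose B := (\bigcap_(i in [set: 'I_k]) [set s : seqk | (0 <= tnth s i :> R)%R])%classic.
pose C := [set s : seqk | \sum_(i < k) tnth s i = 1 :> R]%classic.
have -> : mass_partitions R k = (A `&` B `&` C)%classic.
  apply/seteqP; split => [s [h1 h2 h3]|s [[h1 h2] h3]].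
    by split=> //; split=> [[i j] /= ij|i _]; [exact: h1|exact: h2].
  by split=> // [i j ij|i]; [exact: (h1 (i, j))|exact: h2].
have mle (f g : seqk -> R) : measurable_fun setT f -> measurable_fun setT g ->
    measurable [set s | f s <= g s]%classic.
  by move=> mf mg; rewrite -[X in measurable X]setTI; exact: measurable_fun_le.
apply: measurableI; first apply: measurableI.
- by apply: fin_bigcap_measurable => // p _; exact: mle.
- by apply: fin_bigcap_measurable => // i _; exact: mle.
- have mC : measurable_fun [set: seqk] (fun s => \sum_(i < k) tnth s i : R).
    by apply: measurable_sum => i; exact: mt.
  rewrite (_ : C = [set s | (\sum_(i < k) tnth s i : R) <= 1]
                 `&` [set s | 1 <= (\sum_(i < k) tnth s i : R)])%classic.
    by apply: measurableI; exact: mle.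
  by apply/seteqP; split=> [s /= ->//|s [/= h1 h2]]; apply/eqP; rewrite eq_le h1 h2.
Qed.

Lemma measurable_paintbox c sigma :
  measurable_fun [set: seqk] (fun s => paintbox s c sigma : R).
Proof.
rewrite (_ : (fun s => _) = fun s : seqk => \sum_(x : {ffun 'I_n -> 'I_k})
    if restr (label_partition x) c == sigma then \prod_(i < n) tnth s (x i) else 0);
  last by apply/funext => s; exact: big_mkcond.
apply: measurable_sum => x; case: (restr _ c == sigma) => //.
by apply: measurable_prod => i _; exact: measurable_tnth.
Qed.

Lemma paintbox_ge0 s c sigma : mass_partitions R k s -> 0 <= paintbox s c sigma.
Proof.
move=> [_ s0 _]; apply: sumr_ge0 => x _; apply: prodr_ge0 => i _; exact: s0.
Qed.

Lemma sum_labellings s : mass_partitions R k s ->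
  \sum_(x : {ffun 'I_n -> 'I_k}) \prod_(i < n) tnth s (x i) = 1 :> R.
Proof.
move=> [_ _ s1].
by rewrite -(bigA_distr_bigA (fun (i : 'I_n) (j : 'I_k) => tnth s j)) s1 big1.
Qed.

Lemma paintbox_le1 s c sigma : mass_partitions R k s -> paintbox s c sigma <= 1.
Proof.
move=> ms; rewrite -(sum_labellings ms) /paintbox big_mkcond.
by apply: ler_sum => x _; case: ifP => // _; apply: prodr_ge0 => i _; case: ms.
Qed.

Lemma sum_paintbox s c : mass_partitions R k s ->
  \sum_(sigma | finset.partition sigma c && (#|sigma| <= k)%N) paintbox s c sigma = 1.
Proof.
move=> ms; rewrite -(sum_labellings ms).
by rewrite -(sum_restr_preim_partition _ c) card_ord.
Qed.

Variable nu : probability seqk R.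

Lemma integrable_paintbox c sigma :
  nu.-integrable (mass_partitions R k) (EFin \o (fun s => paintbox s c sigma)).
Proof.
apply: measurable_bounded_integrable; first exact: measurable_mass_partitions.
- by rewrite (le_lt_trans (probability_le1 _ measurable_mass_partitions)) // ltry.
- apply: measurable_funTS; exact: measurable_paintbox.
exists 1; split=> // M M1 s ms.
by rewrite /= ger0_norm ?paintbox_ge0 // (le_trans (paintbox_le1 _ _ ms)) // ltW.
Qed.

Lemma paintbox_mix_ge0 c sigma : 0 <= paintbox_mix nu c sigma.
Proof. by apply: Rintegral_ge0 => s; exact: paintbox_ge0. Qed.

Lemma EFin_paintbox_mix c sigma :
  (paintbox_mix nu c sigma)%:E
  = (\int[nu]_(s in mass_partitions R k) (paintbox s c sigma)%:E)%E.
Proof.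
rewrite fineK //; apply: integrable_fin_num; first exact: measurable_mass_partitions.
exact: integrable_paintbox.
Qed.

Hypothesis nu_supp : nu (mass_partitions R k) = 1%E.

Lemma sum_paintbox_mix c :
  \sum_(sigma | finset.partition sigma c && (#|sigma| <= k)%N)
    paintbox_mix nu c sigma = 1.
Proof.
apply/EFin_inj; rewrite -sumEFin.
under eq_bigr do rewrite EFin_paintbox_mix.
rewrite -integral_sum; first last.
- by move=> sigma; exact: integrable_paintbox.
- exact: measurable_mass_partitions.
rewrite (eq_integral (cst 1%E)) => [|s]; last first.
  by rewrite inE => ms; rewrite sumEFin sum_paintbox.
rewrite integral_cst; first by rewrite mul1e; exact: nu_supp.
exact: measurable_mass_partitions.
Qed.

Hypothesis nu_nontriv : (nu [set unit_mass R k]%classic < 1)%E.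

(** The indices [j0] and [j1] are those of s_1 and s_2. By monotonicity every mass after the first
    vanishes, and the total mass makes the first equal to 1. *)
Lemma mass_partition_unit (j0 j1 : 'I_k) s : val j0 = 0%N -> val j1 = 1%N ->
  mass_partitions R k s -> tnth s j1 <= 0 -> s = unit_mass R k.
Proof.
move=> j00 j11 [smon s0 s1] sj1.
have sz (j : 'I_k) : j != j0 -> tnth s j = 0.
  move=> jj0; apply/eqP; rewrite eq_le s0 andbT (le_trans _ sj1) // smon // j11.
  by rewrite lt0n -j00.
apply: eq_from_tnth => i; rewrite tnth_mktuple.
have [->|ij0] := eqVneq i j0; last first.
  by rewrite sz //; move: ij0; rewrite -val_eqE j00 => /negPf->.
by move: s1; rewrite (bigD1 j0) //= big1 ?addr0 // j00.
Qed.

(** The labelling [x] alone contributes a product of factors s_1 and s_2, which is positive as soon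
    as s_2 > 0. *)
Lemma paintbox_mix_gt0 (x : {ffun 'I_n -> 'I_k}) c (j0 j1 : 'I_k) :
  val j0 = 0%N -> val j1 = 1%N ->
  (forall i, x i \in [:: j0; j1]) ->
  0 < paintbox_mix nu c (preim_partition x c).
Proof.
move=> j00 j11 x01; apply: Rintegral_gt0.
- exact: measurable_mass_partitions.
- exact: integrable_paintbox.
- by move=> s; exact: paintbox_ge0.
move=> [N [mN nuN DN]].
have ms1 : measurable [set unit_mass R k]%classic.
  rewrite (_ : [set unit_mass R k]%classic = \bigcap_(i in [set: 'I_k])
      ((fun s : seqk => tnth s i) @^-1` [set tnth (unit_mass R k) i]))%classic.
    apply: fin_bigcap_measurable => // i _; rewrite -[X in measurable X]setTI.
    exact: measurable_tnth.
  apply/seteqP; split=> [s -> //|s /= h]; apply: eq_from_tnth => i; exact: h.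
(* If the paintbox were positive only on a part of the null set [N], the mass partitions would be
   covered by [N] and (1,0,...,0), contradicting [nu_nontriv]. *)
have : (1 <= nu [set unit_mass R k]%classic)%E.
  rewrite -nu_supp; apply: (@le_trans _ _ (nu ([set unit_mass R k] `|` N)%classic)).
    apply: le_measure.
    - by rewrite inE; exact: measurable_mass_partitions.
    - by rewrite inE; exact: measurableU.
    move=> s ms /=; have [sj|sj] := leP (tnth s j1) 0.
      by left; exact: (mass_partition_unit j00 j11 ms sj).
    right; apply: DN; split=> //=.
    have [smon s0 _] := ms.
    have pos : 0 < \prod_(i < n) tnth s (x i).
      apply: prodr_gt0 => i _; have := x01 i; rewrite !inE => /orP[]/eqP-> //.
      by rewrite (lt_le_trans sj) // smon // j00.
    rewrite (lt_le_trans pos) // /paintbox (bigD1 x) /=; last first.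
      by rewrite restr_preim_partition // finset.subsetT.
    by rewrite lerDl sumr_ge0 // => y _; apply: prodr_ge0 => *; exact: s0.
  by rewrite (le_trans (measureU2 _ _ _)) // [X in (_ + X)%E]nuN adde0.
by rewrite leNgt nu_nontriv.
Qed.

End Paintbox.

(** * The ancestral branching kernel: stochasticity and a positive column *)

Section BranchingKernel.
Variables (R : realType) (k n : nat).
Hypothesis k2 : (2 <= k)%N.
Variable nu : probability (k.-tuple (measurableTypeR R)) R.
Hypothesis nu_supp : nu (mass_partitions R k) = 1%E.
Hypothesis nu_nontriv : (nu [set unit_mass R k]%classic < 1)%E.
Implicit Types (b c : {set 'I_n}) (pi : {set {set 'I_n}}) (T : fragtree k n).

Lemma cp_prob_ge0 pi pi' : 0 <= cp_prob nu pi pi'.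
Proof.
rewrite mulr_ge0 ?divr_ge0 // prodr_ge0 // => c _.
by rewrite mulr_ge0 ?divr_ge0 // paintbox_mix_ge0.
Qed.

Lemma sum_cp_prob pi b : finset.partition pi b ->
  \sum_(pi' | finset.partition pi' b && (#|pi'| <= k)%N) cp_prob nu pi pi' = 1.
Proof.
move=> pib.
have := @sum_cut_and_paste _ 'I_k _ (paintbox_mix nu) pi b.
rewrite card_ord; apply=> //; first exact: ltn_trans k2.
by move=> c _; exact: sum_paintbox_mix.
Qed.

(** One labelling with labels [j0] and [j1] induces [pi'] and all its restrictions to blocks of
    [pi], so every paintbox factor is positive. *)
Lemma cp_prob_gt0 pi pi' b : finset.partition pi b -> finset.partition pi' b ->
  #|pi'| = 2%N -> 0 < cp_prob nu pi pi'.
Proof.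
move=> pib pib' pi2; have /and3P[/eqP cov _ _] := pib.
pose j0 : 'I_k := Ordinal (ltn_trans (ltnSn 0) k2); pose j1 : 'I_k := Ordinal k2.
have [x x01 xE] := two_block_labelling (isT : j0 != j1) pib' pi2.
have fact_gt0' m : 0 < m`!%:R :> R by rewrite ltr0n fact_gt0.
rewrite mulr_gt0 ?divr_gt0 // prodr_gt0 // => c cpi.
rewrite mulr_gt0 ?divr_gt0 // -xE restr_preim_partition.
  exact: (paintbox_mix_gt0 _ _ _ (j0 := j0) (j1 := j1)).
by rewrite -cov; apply: (finset.bigcup_max c).
Qed.

Lemma cp_prob_one_block_lt1 pi b : finset.partition pi b -> (2 <= #|b|)%N ->
  cp_prob nu pi [set b] < 1.
Proof.
move=> pib b2; have [pi' pib' pi2] := exists_two_block_partition b2.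
have b0 : b != finset.set0 by rewrite -card_gt0 (ltn_trans _ b2).
rewrite -(sum_cp_prob pib) (bigD1 [set b]) /=; last first.
  by rewrite partition_one_block // cards1 (ltn_trans _ k2).
rewrite ltrDl (bigD1 pi') /=; last first.
  by rewrite pib' pi2 k2; apply: contra_eq_neq pi2 => ->; rewrite cards1.
by rewrite ltr_wpDr ?(cp_prob_gt0 pib pib') // sumr_ge0 // => *; exact: cp_prob_ge0.
Qed.

Lemma partition_root_restr T b : (2 <= #|b|)%N ->
  finset.partition (root_partition b (restr (val T) b)) b.
Proof.
move=> b2; have /andP[fT _] := valP T; apply: partition_children => //.
apply: is_fragtree_restr fT _ _; first exact: finset.subsetT.
by rewrite -card_gt0 (ltn_trans _ b2).
Qed.

Lemma root_restr T b : b \in val T ->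
  root_partition b (restr (val T) b) = children (val T) b.
Proof.
move=> bT; have /andP[fT _] := valP T.
by rewrite (restr_subtree fT) // /root_partition (children_subtree fT).
Qed.

(** On partitions of [b] with at least two blocks, this is the cut-and-paste law conditioned on
    actually splitting [b]. *)
Definition split_prob T b pi' : R :=
  cp_prob nu (root_partition b (restr (val T) b)) pi'
  / (1 - cp_prob nu (root_partition b (restr (val T) b)) [set b]).

(** This is the product form of [sum_trees]: at a vertex [b] of [T'], the root partition of the
    restricted tree is the set of children of [b] in [T']. *)
Lemma branching_kernelE T T' :
  branching_kernel nu T T' =
  \prod_(b in val T' | (2 <= #|b|)%N) split_prob T b (children (val T') b).
Proof. by apply: eq_bigr => b /andP[bT _]; rewrite /split_prob -root_restr. Qed.

Lemma split_prob_ge0 T b pi' : (2 <= #|b|)%N -> 0 <= split_prob T b pi'.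
Proof.
move=> b2; rewrite divr_ge0 ?cp_prob_ge0 // subr_ge0 ltW //.
exact: cp_prob_one_block_lt1 (partition_root_restr T b2) b2.
Qed.

(** The only partition of [b] with fewer than two blocks is the one-block partition, so the
    numerators add up to the denominator. *)
Lemma sum_split_prob T b : (2 <= #|b|)%N ->
  \sum_(pi' | [&& finset.partition pi' b, (2 <= #|pi'|)%N & (#|pi'| <= k)%N])
     split_prob T b pi' = 1.
Proof.
move=> b2; have pib := partition_root_restr T b2.
have b0 : b != finset.set0 by rewrite -card_gt0 (ltn_trans _ b2).
have lt1 := cp_prob_one_block_lt1 pib b2.
rewrite -mulr_suml (_ : \sum_(pi' | _) _ = 1 -
    cp_prob nu (root_partition b (restr (val T) b)) [set b]).
  by rewrite divff // subr_eq0 gt_eqF.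
rewrite -[X in _ = X - _](sum_cp_prob pib)
        [X in _ = X - _](bigD1 [set b]) /=; last first.
  by rewrite partition_one_block // cards1 (ltn_trans _ k2).
rewrite [RHS]addrC addKr; apply: eq_bigl => pi'; rewrite andbAC andbA.
case: (boolP (finset.partition pi' b)) => //= pib'.
by rewrite -(partition_card_lt2 b0 pib') -leqNgt.
Qed.

Lemma branching_kernel_ge0 T T' : 0 <= branching_kernel nu T T'.
Proof.
by rewrite branching_kernelE prodr_ge0 // => b /andP[_]; exact: split_prob_ge0.
Qed.

Lemma sum_branching_kernel T : (0 < n)%N ->
  \sum_(T' : fragtree k n) branching_kernel nu T T' = 1.
Proof.
move=> n0; have A0 : [set: 'I_n] != finset.set0 by rewrite -card_gt0 cardsT card_ord.
rewrite -[RHS](sum_trees (sum_split_prob T) A0).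
(* Passes from the set [trees] of all admissible trees to the subtype [fragtree]. *)
rewrite [RHS](reindex_omap (val : fragtree k n -> _) insub) /=; last first.
  by move=> T'; rewrite inE => TT; rewrite insubT.
apply: eq_big => [T'|T' _]; last exact: branching_kernelE.
by rewrite inE valK eqxx andbT (valP T').
Qed.

Lemma branching_kernel_gt0 T T' :
  {in val T', forall b, (2 <= #|b|)%N -> #|children (val T') b| = 2%N} ->
  0 < branching_kernel nu T T'.
Proof.
move=> T'2; rewrite branching_kernelE prodr_gt0 // => b /andP[bT b2].
have pib := partition_root_restr T b2.
rewrite divr_gt0 ?subr_gt0 ?(cp_prob_one_block_lt1 pib) //.
apply: (cp_prob_gt0 pib); last exact: T'2.
by rewrite -root_restr // partition_root_restr.
Qed.

Lemma exists_binary_fragtree : (0 < n)%N -> exists T : fragtree k n,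
  {in val T, forall b, (2 <= #|b|)%N -> #|children (val T) b| = 2%N}.
Proof.
move=> n0; have A0 : [set: 'I_n] != finset.set0 by rewrite -card_gt0 cardsT card_ord.
have [T] := exists_binary_tree k2 A0; rewrite inE => TT T2.
by exists (exist _ T TT).
Qed.

End BranchingKernel.

Theorem proposition5p2 (R : realType) (k : nat) (hk : (2 <= k)%N)
    (nu : probability (k.-tuple (measurableTypeR R)) R)
    (nu_supp : nu (mass_partitions R k) = 1%E)
    (nu_nontriv : (nu [set unit_mass R k]%classic < 1)%E) :
  forall n : nat, (1 <= n)%N ->
    exists! rho : {ffun fragtree k n -> R},
      is_distribution rho /\ is_stationary (branching_kernel nu) rho.
Proof.
move=> n n0; have [T0 T02] := exists_binary_fragtree hk n0.
have Q0 := branching_kernel_ge0 hk nu_supp nu_nontriv (n := n).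
have Q1 T := sum_branching_kernel hk nu_supp nu_nontriv T n0.
have [|rho [rho1 rhoQ]] := exists_stationary_distribution Q0 Q1.
  by apply/card_gt0P; exists T0.
exists rho; split=> // sigma [sigma1 sigmaQ].
apply: (unique_stationary_distribution Q0 Q1 (y0 := T0)) => // T.
exact: branching_kernel_gt0.
Qed.
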